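(* Let $q\in\mathbb{C}$ with $|q|<1$, let $n$ be a non-negative integer, and let $b,x,y\in\mathbb{C}$ with $|xy|<1$ and $|by|<1$. Then \[ \sum_{m=0}^{\infty}\Phi_{m}^{(q^n)}(b,x|q)\frac{y^m}{(q;q)_{m}}=\frac{(q^{n}by;q)_{\infty}}{(xy;q)_{\infty}(by;q)_{\infty}}. \]
   Context: For $a\in\mathbb{C}$ and integers $n\ge 0$, $(a;q)_n=\prod_{k=0}^{n-1}(1-q^k a)$ and $(a;q)_\infty=\prod_{k=0}^{\infty}(1-aq^k)$. The $q$-binomial coefficient is $\genfrac{[}{]}{0pt}{}{m}{k}_q=\frac{(q;q)_m}{(q;q)_k(q;q)_{m-k}}$. The homogeneous Hahn polynomials are $\Phi_{m}^{(\alpha)}(x,y|q)=\sum_{k=0}^{m}\genfrac{[}{]}{0pt}{}{m}{k}_{q}(\alpha;q)_{k}x^ky^{m-k}$; thus $\Phi_{m}^{(q^n)}(b,x|q)=\sum_{k=0}^{m}\genfrac{[}{]}{0pt}{}{m}{k}_{q}(q^n;q)_{k}b^kx^{m-k}$. *)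

(* Defs.v *)
From Stdlib Require Import Reals.
From Coquelicot Require Import Coquelicot.

Open Scope C_scope.

(* (a;q)_n *)
Fixpoint qpoch (a q : C) (n : nat) : C :=
  match n with
  | O => 1
  | S k => qpoch a q k * (1 - q ^ k * a)
  end.

(* (a;q)_oo, the limit of (a;q)_n as n tends to infinity; like every [iota], it
   is meaningful only when that limit exists, which is so for |q| < 1. *)
Definition qpoch_inf (a q : C) : C :=
  @iota C_CompleteNormedModule
    (fun l : C => filterlim (qpoch a q) eventually (locally l)).

Definition qbinom (q : C) (m k : nat) : C :=
  qpoch q q m / (qpoch q q k * qpoch q q (m - k)).

(* Phi_m^(alpha)(x, y | q). [sum_n f m] is f 0 + ... + f m, both ends included. *)
Definition hahn (m : nat) (alpha x y q : C) : C :=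
  sum_n (fun k : nat => qbinom q m k * qpoch alpha q k * x ^ k * y ^ (m - k)) m.

(* Main.v *)
(* The series is the Cauchy product of two instances of the q-binomial theorem,
   sum_k (a;q)_k/(q;q)_k z^k = (az;q)_oo/(z;q)_oo for |z| < 1, namely
   (a, z) = (q^n, by) and (0, xy). Writing f(z) for that sum, comparison of
   coefficients gives (1 - z) f(z) = (1 - az) f(qz), hence
   (z;q)_N f(z) = (az;q)_N f(q^N z), and f(q^N z) -> f(0) = 1. The case a = 0
   reads (z;q)_oo f(z) = 1, so (z;q)_oo is nonzero. *)
Require Import Defs.
From Stdlib Require Import Reals Lra Lia.
From Coquelicot Require Import Coquelicot.

Open Scope C_scope.

(** * Complex series and limits *)

Lemma Re_sum_n (u : nat -> C) (n : nat) :
  Re (sum_n u n) = sum_n (fun k => Re (u k)) n.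
Proof.
induction n as [|n IH]; [now rewrite !sum_O|].
now rewrite !sum_Sn, <- IH.
Qed.

Lemma Im_sum_n (u : nat -> C) (n : nat) :
  Im (sum_n u n) = sum_n (fun k => Im (u k)) n.
Proof.
induction n as [|n IH]; [now rewrite !sum_O|].
now rewrite !sum_Sn, <- IH.
Qed.

(** Balls in the product uniform structure of [C] are products of real balls, so convergence is
    componentwise. *)
Lemma is_series_Re_Im (u : nat -> C) (l : C) :
  is_series u l <->
  is_series (fun k => Re (u k)) (Re l) /\ is_series (fun k => Im (u k)) (Im l).
Proof.
split.
- intros H; pose proof (proj1 (filterlim_locally _ _) H) as H'.
  split; apply filterlim_locally; intros eps; generalize (H' eps);
    apply filter_imp; intros k [H1 H2].
  + now rewrite <- Re_sum_n.
  + now rewrite <- Im_sum_n.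
- intros [H1 H2]; apply filterlim_locally; intros eps.
  generalize (filter_and _ _ (proj1 (filterlim_locally _ _) H1 eps)
                             (proj1 (filterlim_locally _ _) H2 eps)).
  apply filter_imp; intros k [h1 h2]; split.
  + now rewrite <- Re_sum_n in h1.
  + now rewrite <- Im_sum_n in h2.
Qed.

Lemma im_le_Cmod (c : C) : (Rabs (Im c) <= Cmod c)%R.
Proof. exact (Rle_trans _ _ _ (Rmax_r _ _) (Rmax_Cmod c)). Qed.

(** Reduces to four real Cauchy products of real and imaginary parts, which converge absolutely
    because |Re w| and |Im w| are at most |w|. *)
Lemma is_series_Cmult (u v : nat -> C) (lu lv : C) :
  is_series u lu -> is_series v lv ->
  ex_series (fun n => Cmod (u n)) -> ex_series (fun n => Cmod (v n)) ->
  is_series (fun n => sum_n (fun k => u k * v (n - k)%nat) n) (lu * lv).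
Proof.
intros Hu Hv Au Av.
apply is_series_Re_Im in Hu; destruct Hu as [Hu1 Hu2].
apply is_series_Re_Im in Hv; destruct Hv as [Hv1 Hv2].
assert (HR : forall w : nat -> C, ex_series (fun n => Cmod (w n)) ->
  ex_series (fun n => Rabs (Re (w n)))).
{ intros w; apply @ex_series_le; intros n.
  unfold norm; simpl; unfold abs; simpl; rewrite Rabs_Rabsolu; apply re_le_Cmod. }
assert (HI : forall w : nat -> C, ex_series (fun n => Cmod (w n)) ->
  ex_series (fun n => Rabs (Im (w n)))).
{ intros w; apply @ex_series_le; intros n.
  unfold norm; simpl; unfold abs; simpl; rewrite Rabs_Rabsolu; apply im_le_Cmod. }
pose proof (is_series_mult _ _ _ _ Hu1 Hv1 (HR _ Au) (HR _ Av)) as H11.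
pose proof (is_series_mult _ _ _ _ Hu1 Hv2 (HR _ Au) (HI _ Av)) as H12.
pose proof (is_series_mult _ _ _ _ Hu2 Hv1 (HI _ Au) (HR _ Av)) as H21.
pose proof (is_series_mult _ _ _ _ Hu2 Hv2 (HI _ Au) (HI _ Av)) as H22.
apply is_series_Re_Im; split.
- generalize (is_series_minus _ _ _ _ H11 H22); apply is_series_ext; intros n.
  rewrite Re_sum_n, sum_n_Reals; symmetry.
  exact (minus_sum (fun k => _ * _)%R (fun k => _ * _)%R n).
- generalize (is_series_plus _ _ _ _ H12 H21); apply is_series_ext; intros n.
  rewrite Im_sum_n, sum_n_Reals; symmetry.
  exact (plus_sum (fun k => _ * _)%R (fun k => _ * _)%R n).
Qed.

(** Turns complex limits into real ones, to which comparison and squeezing apply. *)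
Lemma filterlim_Cmod (u : nat -> C) (l : C) :
  is_lim_seq (fun n => Cmod (u n - l)) 0 <-> filterlim u eventually (locally l).
Proof.
rewrite (filterlim_locally_ball_norm (U := C_NormedModule)).
rewrite <- is_lim_seq_spec.
split; intros H eps; generalize (H eps); apply filter_imp; intros n;
  unfold ball_norm; change (norm ?u) with (Cmod u);
  rewrite Rminus_0_r, (Rabs_pos_eq _ (Cmod_ge_0 _)); auto.
Qed.

Lemma filterlim_Cmult (u v : nat -> C) (lu lv : C) :
  filterlim u eventually (locally lu) -> filterlim v eventually (locally lv) ->
  filterlim (fun n => u n * v n) eventually (locally (lu * lv)).
Proof.
intros Hu Hv.
apply (@filterlim_comp_2 _ C C C eventually
  (locally (T := AbsRing_UniformSpace C_AbsRing) lu)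
  (locally lv) (locally (lu * lv)) _ u v Cmult).
(* Scalars carry the uniform structure of the absolute ring, vectors the product one; [locally_C]
   identifies their neighbourhoods. *)
- intros P HP; apply Hu; now apply locally_C.
- exact Hv.
- exact (@filterlim_scal C_AbsRing C_NormedModule lu lv).
Qed.

(** * A majorant and absolute convergence *)

(* Majorises both (a;q)_k/(q;q)_k z^k and (a;q)_k q^k when A = |a|, r = |q| and
   |z|, |q| <= t. Taking t > 0 keeps the terms nonzero, as the ratio test
   requires, even if some (a;q)_k, q or z vanishes. *)
Fixpoint qmaj (A r t : R) (k : nat) : R :=
  match k with
  | O => 1%R
  | S k => (qmaj A r t k * ((1 + A * r ^ k) / (1 - r ^ S k) * t))%R
  end.

Lemma one_minus_pow_pos (r : R) (k : nat) :
  (0 <= r < 1)%R -> (0 < 1 - r ^ S k)%R.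
Proof.
intros Hr; enough (r ^ S k < 1)%R by lra.
now apply pow_lt_1_compat; [lra|lia].
Qed.

Lemma qmaj_pos (A r t : R) (k : nat) :
  (0 <= A)%R -> (0 <= r < 1)%R -> (0 < t)%R -> (0 < qmaj A r t k)%R.
Proof.
intros HA Hr Ht; induction k as [|k IH]; simpl; [lra|].
apply Rmult_lt_0_compat; [exact IH|].
apply Rmult_lt_0_compat; [|exact Ht].
apply Rdiv_lt_0_compat; [|exact (one_minus_pow_pos r k Hr)].
pose proof (Rmult_le_pos _ _ HA (pow_le r k (proj1 Hr))); lra.
Qed.

(** Ratio test: since r^k -> 0, the ratio of consecutive terms tends to t < 1. *)
Lemma ex_series_qmaj (A r t : R) :
  (0 <= A)%R -> (0 <= r < 1)%R -> (0 < t < 1)%R -> ex_series (qmaj A r t).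
Proof.
intros HA Hr Ht.
assert (Hpos : forall k, (0 < qmaj A r t k)%R) by (intros k; apply qmaj_pos; lra).
apply ex_series_ext with (fun k => Rabs (qmaj A r t k)).
{ intros k; apply Rabs_pos_eq, Rlt_le, Hpos. }
apply ex_series_DAlembert with t; [lra|intros k; specialize (Hpos k); lra|].
assert (Hr0 : is_lim_seq (fun k => r ^ k)%R 0)
  by (apply is_lim_seq_geom; rewrite Rabs_pos_eq; lra).
apply is_lim_seq_ext with (fun k => (1 + A * r ^ k) / (1 - r ^ S k) * t)%R.
{ intros k; pose proof (Hpos k) as H1; pose proof (Hpos (S k)) as H2.
  rewrite Rabs_pos_eq by (apply Rlt_le, Rdiv_lt_0_compat; assumption).
  pose proof (one_minus_pow_pos r k Hr) as H3.
  cbn [qmaj]; field; split; lra. }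
replace (Finite t) with (Finite ((1 + A * 0) / (1 - 0) * t)) by (f_equal; field).
apply is_lim_seq_mult'; [|apply is_lim_seq_const].
apply is_lim_seq_div'; [| |lra].
- apply is_lim_seq_plus'; [apply is_lim_seq_const|].
  apply is_lim_seq_mult'; [apply is_lim_seq_const|exact Hr0].
- apply is_lim_seq_minus'; [apply is_lim_seq_const|].
  exact (proj1 (is_lim_seq_incr_1 _ _) Hr0).
Qed.

Lemma Cmod_one_minus_pow_ge (q : C) (k : nat) :
  (Cmod q < 1)%R -> (1 - Cmod q ^ S k <= Cmod (1 - q ^ S k))%R.
Proof.
intros Hq; pose proof (Cmod_triangle (1 - q ^ S k) (q ^ S k)) as H.
replace (1 - q ^ S k + q ^ S k) with (RtoC 1) in H by ring.
rewrite Cmod_1, Cmod_pow in H; lra.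
Qed.

Lemma one_minus_Cpow_neq0 (q : C) (k : nat) : (Cmod q < 1)%R -> 1 - q ^ S k <> 0.
Proof.
intros Hq; apply Cmod_gt_0.
pose proof (Cmod_one_minus_pow_ge q k Hq).
pose proof (one_minus_pow_pos (Cmod q) k (conj (Cmod_ge_0 q) Hq)); lra.
Qed.

Lemma qpoch_qq_neq0 (q : C) (k : nat) : (Cmod q < 1)%R -> qpoch q q k <> 0.
Proof.
intros Hq; induction k as [|k IH]; simpl; [exact C1_nz|].
apply Cmult_neq_0; [exact IH|].
replace (q ^ k * q) with (q ^ S k) by (simpl; ring).
now apply one_minus_Cpow_neq0.
Qed.

Lemma Cmod_one_minus_pow_mult_le (a q : C) (k : nat) :
  (Cmod (1 - q ^ k * a) <= 1 + Cmod a * Cmod q ^ k)%R.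
Proof.
unfold Cminus; eapply Rle_trans; [apply Cmod_triangle|].
rewrite Cmod_opp, Cmod_1, Cmod_mult, Cmod_pow; lra.
Qed.

Definition qcoef (a q : C) (k : nat) : C := qpoch a q k / qpoch q q k.

Lemma qcoef_S (a q : C) (k : nat) : (Cmod q < 1)%R ->
  qcoef a q (S k) * (1 - q ^ S k) = qcoef a q k * (1 - q ^ k * a).
Proof.
intros Hq; unfold qcoef; cbn [qpoch].
replace (q ^ k * q) with (q ^ S k) by (simpl; ring).
pose proof (qpoch_qq_neq0 q k Hq); pose proof (one_minus_Cpow_neq0 q k Hq).
now field.
Qed.

(** Consecutive terms have ratio (1 - q^k a) / (1 - q^(k+1)) z. The triangle inequality bounds its
    numerator above and its denominator below, which gives the ratio of [qmaj]. *)
Lemma qcoef_le_qmaj (a q z : C) (t : R) (k : nat) :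
  (Cmod q < 1)%R -> (0 < t)%R -> (Cmod z <= t)%R ->
  (Cmod (qcoef a q k * z ^ k) <= qmaj (Cmod a) (Cmod q) t k)%R.
Proof.
intros Hq Ht Hz; induction k as [|k IH].
{ unfold qcoef; simpl; replace (1 / 1 * 1) with (RtoC 1) by field.
  rewrite Cmod_1; lra. }
pose proof (one_minus_Cpow_neq0 q k Hq) as Hk.
pose proof (Cmod_one_minus_pow_ge q k Hq) as H1.
pose proof (one_minus_pow_pos (Cmod q) k (conj (Cmod_ge_0 q) Hq)) as H2.
replace (qcoef a q (S k) * z ^ S k)
  with (qcoef a q k * z ^ k * ((1 - q ^ k * a) / (1 - q ^ S k) * z)).
2:{ rewrite Cpow_S with (c := z).
    replace (qcoef a q (S k)) with (qcoef a q (S k) * (1 - q ^ S k) / (1 - q ^ S k))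
      by (field; exact Hk).
    rewrite (qcoef_S a q k Hq); field; exact Hk. }
cbn [qmaj]; rewrite Cmod_mult.
apply Rmult_le_compat; try apply Cmod_ge_0; [exact IH|].
rewrite Cmod_mult.
apply Rmult_le_compat; try apply Cmod_ge_0; [|exact Hz].
rewrite Cmod_div by exact Hk.
apply Rmult_le_compat; [apply Cmod_ge_0| |apply Cmod_one_minus_pow_mult_le|].
- apply Rlt_le, Rinv_0_lt_compat; lra.
- apply Rinv_le_contravar; assumption.
Qed.

Lemma ex_series_qcoef (a q z : C) :
  (Cmod q < 1)%R -> (Cmod z < 1)%R ->
  ex_series (fun k => Cmod (qcoef a q k * z ^ k)).
Proof.
intros Hq Hz; pose proof (Cmod_ge_0 z); pose proof (Cmod_ge_0 q).
(* The midpoint of |z| and 1 is below 1, and positive even when z = 0. *)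
apply @ex_series_le with (b := qmaj (Cmod a) (Cmod q) ((1 + Cmod z) / 2)).
- intros k; unfold norm; simpl; unfold abs; simpl.
  rewrite (Rabs_pos_eq _ (Cmod_ge_0 _)).
  apply qcoef_le_qmaj; lra.
- apply ex_series_qmaj; [apply Cmod_ge_0|lra|lra].
Qed.

(** * Convergence of the infinite product *)

(** The product is treated as a telescoping series whose terms (a;q)_k q^k a are dominated by |a|
    times [qmaj]. *)
Lemma qpoch_cv (a q : C) : (Cmod q < 1)%R ->
  filterlim (qpoch a q) eventually (locally (qpoch_inf a q)).
Proof.
intros Hq.
assert (Hs : ex_series (V := C_NormedModule) (fun k => qpoch a q k * (q ^ k * a))).
{ pose proof (Cmod_ge_0 q); set (t := ((1 + Cmod q) / 2)%R).
  apply @ex_series_le with (V := C_CompleteNormedModule)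
    (b := fun k => (qmaj (Cmod a) (Cmod q) t k * Cmod a)%R).
  2:{ apply ex_series_scal_r, ex_series_qmaj; [apply Cmod_ge_0|lra|unfold t; lra]. }
  intros k; change (norm ?u) with (Cmod u).
  rewrite Cmult_assoc, Cmod_mult.
  apply Rmult_le_compat_r; [apply Cmod_ge_0|].
  rewrite Cmod_mult.
  induction k as [|k IH]; simpl.
  { rewrite Cmod_1; lra. }
  rewrite !Cmod_mult.
  pose proof (one_minus_pow_pos (Cmod q) k (conj (Cmod_ge_0 q) Hq)) as H2.
  replace (Cmod (qpoch a q k) * Cmod (1 - q ^ k * a) * (Cmod q * Cmod (q ^ k)))%R
    with (Cmod (qpoch a q k) * Cmod (q ^ k) * (Cmod (1 - q ^ k * a) * Cmod q))%R by ring.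
  apply Rmult_le_compat; try apply Rmult_le_pos; try apply Cmod_ge_0; [exact IH|].
  apply Rmult_le_compat; try apply Cmod_ge_0; [|unfold t; lra].
  (* Dividing by 1 - |q|^(k+1), which lies in (0, 1], only enlarges the bound. *)
  eapply Rle_trans; [apply Cmod_one_minus_pow_mult_le|].
  assert (0 <= Cmod q ^ S k)%R by (apply pow_le; lra).
  pose proof (Rmult_le_pos _ _ (Cmod_ge_0 a) (pow_le _ k (Cmod_ge_0 q))).
  apply Rmult_le_reg_r with (1 - Cmod q ^ S k)%R; [assumption|].
  unfold Rdiv; rewrite Rmult_assoc.
  change (Cmod q * Cmod q ^ k)%R with (Cmod q ^ S k)%R.
  rewrite Rinv_l by lra.
  nra. }
destruct Hs as [l Hl].
(* (a;q)_k - (a;q)_(k+1) = (a;q)_k q^k a, so the series telescopes. *)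
assert (H : filterlim (qpoch a q) eventually (locally (1 - l))).
{ apply filterlim_Cmod.
  (* The partial sum up to [n], both ends included, is 1 - (a;q)_(n+1), hence the shift of index. *)
  apply is_lim_seq_incr_1.
  apply filterlim_Cmod in Hl.
  revert Hl; apply is_lim_seq_ext; intros n.
  rewrite <- Cmod_opp; f_equal.
  enough (E : sum_n (G := NormedModule.AbelianMonoid _ C_NormedModule)
      (fun k => qpoch a q k * (q ^ k * a)) n = 1 - qpoch a q (S n))
    by (rewrite E; ring).
  induction n as [|n IH]; [rewrite sum_O; simpl; ring|].
  rewrite sum_Sn, IH; unfold plus; simpl; ring. }
replace (qpoch_inf a q) with (1 - l); [exact H|].
symmetry; exact (iota_filterlim_locally (V := C_CompleteNormedModule) (qpoch a q) (1 - l) H).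
Qed.

(** * The q-binomial series and its functional equation *)

Lemma is_series_C_unique (u : nat -> C) (l l' : C) :
  is_series u l -> is_series u l' -> l = l'.
Proof.
exact (filterlim_locally_unique (V := C_NormedModule) (sum_n u) l l').
Qed.

Definition qser (a q z : C) : C :=
  @iota C_CompleteNormedModule
    (fun l : C => is_series (fun k => qcoef a q k * z ^ k) l).

Lemma is_series_qser (a q z : C) :
  (Cmod q < 1)%R -> (Cmod z < 1)%R ->
  is_series (fun k => qcoef a q k * z ^ k) (qser a q z).
Proof.
intros Hq Hz; unfold qser.
apply (iota_correct (V := C_CompleteNormedModule)
  (fun l : C => is_series (fun k => qcoef a q k * z ^ k) l)).
destruct (ex_series_le (V := C_CompleteNormedModule)
  (fun k => qcoef a q k * z ^ k) _ (fun k => Rle_refl _) (ex_series_qcoef a q z Hq Hz))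
  as [l Hl].
exists l; split; [exact Hl|intros l'; exact (is_series_C_unique _ l l' Hl)].
Qed.

Lemma Cmod_mult_pow_lt (q z : C) (N : nat) :
  (Cmod q < 1)%R -> (Cmod z < 1)%R -> (Cmod (q ^ N * z) < 1)%R.
Proof.
intros Hq Hz; rewrite Cmod_mult, Cmod_pow.
pose proof (Cmod_ge_0 q) as H0; pose proof (Cmod_ge_0 z).
assert (Cmod q ^ N <= 1)%R
  by (rewrite <- (pow1 N); apply pow_incr; lra).
pose proof (pow_le _ N H0); nra.
Qed.

(** Rearranges f(z) - f(qz) = z (f(z) - a f(qz)). There the coefficients of z^(k+1) on the two sides
    are c_(k+1) (1 - q^(k+1)) and c_k (1 - q^k a), with c = [qcoef a q]; they agree by [qcoef_S]. *)
Lemma qser_functional (a q z : C) :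
  (Cmod q < 1)%R -> (Cmod z < 1)%R ->
  (1 - z) * qser a q z = (1 - a * z) * qser a q (q * z).
Proof.
intros Hq Hz.
assert (Hqz : (Cmod (q * z) < 1)%R)
  by (pose proof (Cmod_mult_pow_lt q z 1 Hq Hz) as H; now rewrite Cpow_1_r in H).
pose proof (is_series_qser a q z Hq Hz) as Hf.
pose proof (is_series_qser a q (q * z) Hq Hqz) as Hg.
set (f := qser a q z) in *; set (g := qser a q (q * z)) in *.
pose proof (is_series_scal_l (V := C_NormedModule) z _ _
  (is_series_minus _ _ _ _ Hf (is_series_scal_l (V := C_NormedModule) a _ _ Hg))) as H1.
pose proof (is_series_minus _ _ _ _ Hf Hg) as H2.
(* The constant term of f(z) - f(qz) is 0, so dropping it leaves the sum unchanged and aligns the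
   series with the one multiplied by z. *)
assert (H3 := is_series_incr_1 (V := C_NormedModule) (fun k =>
  qcoef a q k * z ^ k - qcoef a q k * (q * z) ^ k) (f - g)).
assert (E : f - g = z * (f - a * g)).
{ refine (is_series_C_unique _ _ _ (H3 _) _).
  - replace (plus _ _) with (f - g); [exact H2|].
    unfold plus; simpl; ring.
  - revert H1; apply is_series_ext; intros k.
    change (z * (qcoef a q k * z ^ k - a * (qcoef a q k * (q * z) ^ k)) =
      qcoef a q (S k) * z ^ S k - qcoef a q (S k) * (q * z) ^ S k).
    rewrite !Cpow_mult_l.
    transitivity (z * z ^ k * (qcoef a q k * (1 - q ^ k * a))); [ring|].
    rewrite <- qcoef_S by exact Hq.
    simpl; ring. }
replace ((1 - z) * f) with (f - g + g - z * f) by ring.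
rewrite E; ring.
Qed.

Lemma qser_iter (a q z : C) (N : nat) :
  (Cmod q < 1)%R -> (Cmod z < 1)%R ->
  qpoch z q N * qser a q z = qpoch (a * z) q N * qser a q (q ^ N * z).
Proof.
intros Hq Hz; induction N as [|N IH].
{ simpl; now rewrite !Cmult_1_l. }
cbn [qpoch].
replace (qpoch z q N * (1 - q ^ N * z) * qser a q z)
  with ((1 - q ^ N * z) * (qpoch z q N * qser a q z)) by ring.
rewrite IH.
replace (q ^ S N * z) with (q * (q ^ N * z)) by (simpl; ring).
transitivity (qpoch (a * z) q N * ((1 - q ^ N * z) * qser a q (q ^ N * z))); [ring|].
rewrite qser_functional; [ring|exact Hq|now apply Cmod_mult_pow_lt].
Qed.

(** The constant term 1 cancels, and every later term carries a factor (q^N)^k with k >= 1, of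
    modulus at most |q|^N. This gives the limit at 0 without continuity of the power series. *)
Lemma qser_near_0 (a q z : C) (N : nat) :
  (Cmod q < 1)%R -> (Cmod z < 1)%R ->
  (Cmod (qser a q (q ^ N * z) - 1)
   <= Cmod q ^ N * Series (fun k => Cmod (qcoef a q k * z ^ k)))%R.
Proof.
intros Hq Hz.
pose proof (ex_series_qcoef a q z Hq Hz) as He.
set (m := fun k => Cmod (qcoef a q k * z ^ k)) in *.
pose proof (is_series_qser a q _ Hq (Cmod_mult_pow_lt q z N Hq Hz)) as Hf.
set (f := qser a q (q ^ N * z)) in *.
set (s := sum_n (G := NormedModule.AbelianMonoid _ C_NormedModule)
  (fun k => qcoef a q k * (q ^ N * z) ^ k)).
assert (Hr : (0 <= Cmod q ^ N <= 1)%R).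
{ pose proof (Cmod_ge_0 q); split; [now apply pow_le|].
  rewrite <- (pow1 N); apply pow_incr; lra. }
assert (Hm : forall n, (sum_n m n <= Series m)%R).
{ intros n; apply (is_lim_seq_incr_compare (sum_n m) (Series m)).
  - exact (Series_correct m He).
  - intros k; rewrite sum_Sn; unfold plus; simpl.
    pose proof (Cmod_ge_0 (qcoef a q (S k) * z ^ S k)) as H.
    unfold m at 3; lra. }
assert (Hs : forall n, (Cmod (s n - 1) <= Cmod q ^ N * sum_n m n)%R).
{ induction n as [|n IH].
  - unfold s; rewrite !sum_O; unfold m, qcoef; simpl.
    replace (1 / 1 * 1 - 1) with (RtoC 0) by field.
    rewrite Cmod_0; apply Rmult_le_pos; [lra|apply Cmod_ge_0].
  - unfold s; rewrite !sum_Sn; fold s; unfold plus; simpl (AbelianMonoid.plus _ _ _ _).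
    change (Cmod (s n + qcoef a q (S n) * (q ^ N * z) ^ S n - 1)
      <= Cmod q ^ N * (sum_n m n + m (S n)))%R.
    replace (s n + qcoef a q (S n) * (q ^ N * z) ^ S n - 1)
      with (s n - 1 + (q ^ N) ^ S n * (qcoef a q (S n) * z ^ S n))
      by (rewrite Cpow_mult_l; ring).
    eapply Rle_trans; [apply Cmod_triangle|].
    rewrite Rmult_plus_distr_l; apply Rplus_le_compat; [exact IH|].
    rewrite Cmod_mult; apply Rmult_le_compat_r; [apply Cmod_ge_0|].
    rewrite !Cmod_pow; simpl.
    assert ((Cmod q ^ N) ^ n <= 1)%R
      by (rewrite <- (pow1 n); apply pow_incr; exact Hr).
    pose proof (pow_le _ n (proj1 Hr)); nra. }
apply filterlim_Cmod in Hf.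
(* The bound on partial sums passes to [f] through |f - 1| <= |s n - f| + |s n - 1|; the 0 is the
   limit of the first summand. *)
assert (H : Rbar_le (Cmod (f - 1)) (0 + Cmod q ^ N * Series m)%R).
2:{ simpl in H; lra. }
apply is_lim_seq_le with (fun _ : nat => Cmod (f - 1))
  (fun n => Cmod (s n - f) + Cmod q ^ N * Series m)%R.
- intros n; replace (f - 1) with (- (s n - f) + (s n - 1)) by ring.
  eapply Rle_trans; [apply Cmod_triangle|].
  rewrite Cmod_opp; apply Rplus_le_compat_l.
  eapply Rle_trans; [apply Hs|].
  apply Rmult_le_compat_l; [apply Hr|apply Hm].
- apply is_lim_seq_const.
- apply is_lim_seq_plus'; [exact Hf|apply is_lim_seq_const].
Qed.

Lemma qser_lim (a q z : C) :
  (Cmod q < 1)%R -> (Cmod z < 1)%R ->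
  filterlim (fun N => qser a q (q ^ N * z)) eventually (locally (RtoC 1)).
Proof.
intros Hq Hz; apply filterlim_Cmod.
set (K := Series (fun k => Cmod (qcoef a q k * z ^ k))).
apply is_lim_seq_le_le with (fun _ => 0%R) (fun N => (Cmod q ^ N * K)%R).
- intros N; split; [apply Cmod_ge_0|now apply qser_near_0].
- apply is_lim_seq_const.
- replace (Finite 0) with (Finite (0 * K)) by (f_equal; ring).
  apply is_lim_seq_mult'; [|apply is_lim_seq_const].
  apply is_lim_seq_geom; rewrite Rabs_pos_eq; [exact Hq|apply Cmod_ge_0].
Qed.

(** * The q-binomial theorem and the generating function *)

(** Both sides are limits of the same sequence, by [qser_iter]. The form without division comes
    first because the nonvanishing of (z;q)_oo is deduced from it. *)
Lemma qpoch_inf_mult_qser (a q z : C) :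
  (Cmod q < 1)%R -> (Cmod z < 1)%R ->
  qpoch_inf z q * qser a q z = qpoch_inf (a * z) q.
Proof.
intros Hq Hz.
apply (filterlim_locally_unique (V := C_NormedModule) (F := eventually)
  (fun N => qpoch z q N * qser a q z)).
- apply filterlim_Cmult; [now apply qpoch_cv|apply filterlim_const].
- apply filterlim_ext with (fun N => qpoch (a * z) q N * qser a q (q ^ N * z)).
  { intros N; symmetry; now apply qser_iter. }
  rewrite <- (Cmult_1_r (qpoch_inf (a * z) q)).
  apply filterlim_Cmult; [now apply qpoch_cv|now apply qser_lim].
Qed.

Lemma qpoch_0 (q : C) (k : nat) : qpoch 0 q k = 1.
Proof. induction k as [|k IH]; simpl; [easy|rewrite IH; ring]. Qed.

Lemma qpoch_inf_0 (q : C) : qpoch_inf 0 q = 1.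
Proof.
apply (iota_filterlim_locally (V := C_CompleteNormedModule)).
apply filterlim_ext with (fun _ => RtoC 1); [|apply filterlim_const].
intros k; symmetry; apply qpoch_0.
Qed.

Lemma qpoch_inf_neq0 (q z : C) :
  (Cmod q < 1)%R -> (Cmod z < 1)%R -> qpoch_inf z q <> 0.
Proof.
intros Hq Hz H0; pose proof (qpoch_inf_mult_qser 0 q z Hq Hz) as H.
rewrite H0, !Cmult_0_l, qpoch_inf_0 in H; now apply C1_nz.
Qed.

Lemma is_series_qbinomial (a q z : C) :
  (Cmod q < 1)%R -> (Cmod z < 1)%R ->
  is_series (fun k => qcoef a q k * z ^ k) (qpoch_inf (a * z) q / qpoch_inf z q).
Proof.
intros Hq Hz.
replace (qpoch_inf (a * z) q / qpoch_inf z q) with (qser a q z).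
- now apply is_series_qser.
- rewrite <- qpoch_inf_mult_qser by assumption.
  field; now apply qpoch_inf_neq0.
Qed.

Theorem theorem8 (q : C) (n : nat) (b x y : C)
  (hq : (Cmod q < 1)%R) (hxy : (Cmod (x * y) < 1)%R) (hby : (Cmod (b * y) < 1)%R) :
  is_series
    (fun m : nat => hahn m (q ^ n) b x q * (y ^ m / qpoch q q m))
    (qpoch_inf (q ^ n * b * y) q / (qpoch_inf (x * y) q * qpoch_inf (b * y) q)).
Proof.
pose proof (is_series_Cmult _ _ _ _
  (is_series_qbinomial (q ^ n) q (b * y) hq hby) (is_series_qbinomial 0 q (x * y) hq hxy)
  (ex_series_qcoef _ _ _ hq hby) (ex_series_qcoef _ _ _ hq hxy)) as H.
rewrite Cmult_0_l, qpoch_inf_0, Cmult_assoc in H.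
replace (qpoch_inf (q ^ n * b * y) q / (qpoch_inf (x * y) q * qpoch_inf (b * y) q))
  with (qpoch_inf (q ^ n * b * y) q / qpoch_inf (b * y) q * (1 / qpoch_inf (x * y) q))
  by (field; split; now apply qpoch_inf_neq0).
revert H; apply is_series_ext; intros m.
unfold hahn.
(* With y^m/(q;q)_m moved inside the sum, (q;q)_m cancels against the numerator of the q-binomial
   coefficient and the terms can be compared one by one. *)
etransitivity; [|exact (sum_n_mult_r (K := C_Ring) _ _ _)].
apply sum_n_ext_loc; intros k Hk.
match goal with |- ?l = mult ?u ?v => change (@eq C l (Cmult u v)) end.
unfold qcoef, qbinom; rewrite qpoch_0, !Cpow_mult_l.
(* The bound k <= m in [Hk] makes the truncated difference m - k exact. *)
replace (y ^ m) with (y ^ k * y ^ (m - k)) by (rewrite <- Cpow_add_r; f_equal; lia).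
field; repeat split; now apply qpoch_qq_neq0.
Qed.
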